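(* There exists a stochastic block model $\mathrm{SBM}(n;p,Q)$ on $2$ balanced communities (i.e. $k=2$, $p=(1/2,1/2)$, with $Q$ allowed to depend on $n$) with the following property. It can be distinguished from $\mathbb{G}(n,1/2)$ with high probability via the signed count of $\mathrm{Star}_2$, but not via the signed count of any other connected graph of constant size (with at least one edge).
   Context: Graphs are finite, simple and undirected. $\mathrm{Star}_2$ is the path with two edges. $\mathbb{G}(n,1/2)$ is the Erdős–Rényi random graph. A stochastic block model on $k$ communities is given by a probability vector $p\in(0,1]^k$ and a symmetric matrix $Q\in[-1,1]^{k\times k}$. A sample $\mathbf{G}\sim\mathrm{SBM}(n;p,Q)$ is an $n$-vertex graph produced by drawing i.i.d. labels $\mathbf{x}_1,\dots,\mathbf{x}_n\in[k]$ with pmf $p$, and then including each edge $(i,j)$ independently with probability $(1+Q_{\mathbf{x}_i,\mathbf{x}_j})/2$. The signed count of $H$ in an $n$-vertex graph $G$ with edge indicators $G_{ij}$ is $\mathrm{SC}_H(G)=\sum_{H_1\sim H}\prod_{(i,j)\in E(H_1)}(2G_{ij}-1)$, the sum over all subgraphs $H_1$ of $K_n$ isomorphic to $H$. With $f=\mathrm{SC}_H$ and $M_n=\max(\mathrm{Var}_{\mathbb{G}(n,1/2)}[f]^{1/2},\mathrm{Var}_{\mathbb{P}_n}[f]^{1/2})$, the signed count of $H$ distinguishes $\mathbb{P}_n$ from $\mathbb{G}(n,1/2)$ (with high probability) if $|\mathbb{E}_{\mathbb{P}_n}f-\mathbb{E}_{\mathbb{G}(n,1/2)}f|=\omega(M_n)$,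 and it fails to distinguish (''not via'') if $|\mathbb{E}_{\mathbb{P}_n}f-\mathbb{E}_{\mathbb{G}(n,1/2)}f|=o(M_n)$, as $n\to\infty$. *)

(* Defs.v *)
From HB Require Import structures.
From mathcomp Require Import all_boot all_order all_algebra.
From mathcomp Require Import all_classical all_reals all_analysis.
Import Order.TTheory GRing.Theory Num.Theory numFieldNormedType.Exports.

Set Implicit Arguments.
Unset Strict Implicit.
Unset Printing Implicit Defensive.

Local Open Scope ring_scope.

Definition edge_set_axiom (T : finType) (E : {set {set T}}) : bool :=
  [forall e in E, #|e| == 2%N].

(* An undirected edge is the set of its two endpoints. *)
Record sgraph (T : finType) := SGraph {
  edges : {set {set T}};
  edgesP : edge_set_axiom edges }.

HB.instance Definition _ (T : finType) := [isSub for @edges T].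
HB.instance Definition _ (T : finType) := [Finite of sgraph T by <:].

Definition adj (T : finType) (G : sgraph T) : rel T :=
  fun x y => [set x; y] \in edges G.

Definition connected_graph (T : finType) (G : sgraph T) : Prop :=
  (0 < #|T|)%N /\ forall x y : T, connect (adj G) x y.

Definition isomorphic (T U : finType) (G : sgraph T) (H : sgraph U) : Prop :=
  exists2 f : T -> U, bijective f & forall x y, adj G x y = adj H (f x) (f y).

Definition star_edges (k : nat) : {set {set 'I_k.+1}} :=
  [set [set ord0; i] | i in [set~ ord0]].

Lemma star_edgesP (k : nat) : edge_set_axiom (star_edges k).
Proof.
apply/forall_inP => e /imsetP[i]; rewrite !inE.
by move=> i0 ->; rewrite cards2 (eq_sym ord0) i0.
Qed.

Definition star (k : nat) : sgraph 'I_k.+1 := SGraph (star_edgesP k).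

(* The subgraphs of K_n isomorphic to H, each given once by its vertex set and *)
(* its edge set: these are the images of H under the injections into 'I_n.     *)
Definition copies (T : finType) (H : sgraph T) (n : nat) :
    {set {set 'I_n} * {set {set 'I_n}}} :=
  [set (f @: [set: T], [set f @: (e : {set T}) | e in edges H])
     | f : {ffun T -> 'I_n} in [pred f : {ffun T -> 'I_n} | injectiveb f]].

Definition signed_count (R : realType) (T : finType) (H : sgraph T) (n : nat)
    (G : sgraph 'I_n) : R :=
  \sum_(H1 in copies H n) \prod_(e in H1.2) (2 * (e \in edges G)%:R - 1).

Definition fexpect (R : realType) (T : finType) (P : T -> R) (f : T -> R) : R :=
  \sum_(t : T) P t * f t.

Definition fvar (R : realType) (T : finType) (P : T -> R) (f : T -> R) : R :=
  fexpect P (fun t => (f t - fexpect P f) ^+ 2).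

(* Law of the graph including each edge {i, j}, i < j, independently with      *)
(* probability q i j.                                                          *)
Definition indep_edges_pmf (R : realType) (n : nat) (q : 'I_n -> 'I_n -> R)
    (G : sgraph 'I_n) : R :=
  \prod_(i < n) \prod_(j < n | (i < j)%N)
     (if adj G i j then q i j else 1 - q i j).

Definition er_pmf (R : realType) (n : nat) : sgraph 'I_n -> R :=
  indep_edges_pmf (fun _ _ => 2^-1).

Definition sbm_params (R : realType) (k : nat) (p : 'rV[R]_k) (Q : 'M[R]_k) :
    Prop :=
  [/\ forall a, 0 < p 0 a <= 1,
      \sum_(a < k) p 0 a = 1,
      forall a b, Q a b = Q b a
    & forall a b, -1 <= Q a b <= 1].

Definition sbm_pmf (R : realType) (k : nat) (p : 'rV[R]_k) (Q : 'M[R]_k)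
    (n : nat) (G : sgraph 'I_n) : R :=
  \sum_(x : {ffun 'I_n -> 'I_k})
     (\prod_(i < n) p 0 (x i)) *
     indep_edges_pmf (fun i j => (1 + Q (x i) (x j)) / 2) G.

Local Open Scope classical_set_scope.

Section distinguishing.
Variables (R : realType) (T : finType) (H : sgraph T).
Variable P : forall n : nat, sgraph 'I_n -> R.

Definition mean_gap (n : nat) : R :=
  `|fexpect (@P n) (signed_count R H (n := n)) -
    fexpect (@er_pmf R n) (signed_count R H (n := n))|.

Definition sd_scale (n : nat) : R :=
  Num.max (Num.sqrt (fvar (@er_pmf R n) (signed_count R H (n := n))))
          (Num.sqrt (fvar (@P n) (signed_count R H (n := n)))).

(* mean_gap = omega(sd_scale). *)
Definition distinguishes : Prop := sd_scale =o_\oo mean_gap.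

Definition fails_to_distinguish : Prop := mean_gap =o_\oo sd_scale.

End distinguishing.

(* Main.v *)
Require Import Defs.
From mathcomp Require Import all_boot all_order all_algebra.
From mathcomp Require Import all_classical all_reals all_analysis.
(* Repeated so that the names of finset shadow those of classical_sets. *)
From mathcomp Require Import fintype finset.
From mathcomp Require Import ring lra zify.
Import Order.TTheory GRing.Theory Num.Theory numFieldNormedType.Exports.

(** Give every vertex i a label sign s_i = +1 or -1 and let the edge {i, j} have
    bias Q = a (s_i + s_j) / 2. The communities have opposite mean biases, so
    the first moment of an edge vanishes while a path with two edges has moment
    a^2 / 4. Globally changing the signs kills every H with an odd number m of
    edges; for the other H the moment is at most a^m.

    The signed count of H under G(n, 1/2) is centered with variance the number N
    of copies, and N <= n^(m + 1) if H is connected. With a = n^(-2/3) the gap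
    of H relative to the null deviation is therefore at most n^((3 - m) / 6),
    which vanishes for even m >= 4, while m = 2 leaves only the star. For the star
    N = Theta(n^3), and the gap N a^2 / 4 exceeds the null deviation by a factor
    of order n^(1/6). Its variance under the block model is still O(N): pairs of
    vertex-disjoint copies are uncorrelated, pairs sharing a vertex contribute
    O(N n^2 a^4), pairs sharing an edge O(N n a^2), equal pairs N, and
    n a^2 <= 1. *)

Set Implicit Arguments.
Unset Strict Implicit.
Unset Printing Implicit Defensive.

Local Open Scope ring_scope.

(** * Sign products under independent edges *)

Lemma card_edge (T : finType) (G : sgraph T) (e : {set T}) :
  e \in edges G -> #|e| = 2%N.
Proof. by move/(forall_inP (edgesP G))/eqP. Qed.

(** Pairs i < j correspond bijectively to two-element sets, the form in which the law of a graph can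
    be expanded over edge sets. *)
Lemma prod_pairs (R : comRingType) (n : nat) (h : {set 'I_n} -> R) :
  \prod_(i < n) \prod_(j < n | (i < j)%N) h [set i; j] =
  \prod_(e : {set 'I_n} | #|e| == 2%N) h e.
Proof.
rewrite pair_big_dep /=.
pose lt2 := [set p : 'I_n * 'I_n | (p.1 < p.2)%N].
pose mk (p : 'I_n * 'I_n) := [set p.1; p.2].
have pair_inj : {in lt2 &, injective mk}.
  case=> [i j] [k l]; rewrite !inE /mk /= => ij kl /setP E.
  move: (E i) (E j) (E k) (E l).
  rewrite !inE !eqxx !orbT /= -!val_eqE /= => e1 e2 e3 e4.
  by congr pair; apply: val_inj => /=; lia.
transitivity (\prod_(p in lt2) h (mk p)).
  by apply: eq_bigl => p; rewrite inE.
rewrite -(big_imset h pair_inj); apply: eq_bigl => e.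
apply/imsetP/cards2P => [[[i j]]|[i [j [ij ->]]]].
  by rewrite inE /= => ij ->; exists i, j; split=> //; rewrite -val_eqE ltn_eqF.
have [lt_ij|lt_ji|/val_inj eq_ij] := ltngtP i j.
- by exists (i, j); rewrite ?inE.
- by exists (j, i); rewrite ?inE //= setUC.
- by rewrite eq_ij eqxx in ij.
Qed.

Lemma sum_sgraph (R : nmodType) (T : finType) (F : {set {set T}} -> R) :
  \sum_(G : sgraph T) F (edges G) =
  \sum_(E : {set {set T}} | edge_set_axiom E) F E.
Proof.
rewrite (reindex_omap (@edges T) insub) => [|E ES]; last by rewrite insubT.
by apply: eq_bigl => G; rewrite edgesP valK eqxx.
Qed.

Definition sign_prod (R : realType) (T : finType) (S : {set {set T}})
    (G : sgraph T) : R :=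
  \prod_(e in S) (2 * (e \in edges G)%:R - 1).

Lemma fexpect_indep_edges (R : realType) (n : nat) (w : {set 'I_n} -> R)
    (q : 'I_n -> 'I_n -> R) (S : {set {set 'I_n}}) :
  (forall i j, i != j -> q i j = (1 + w [set i; j]) / 2) ->
  edge_set_axiom S ->
  fexpect (indep_edges_pmf q) (sign_prod R S) = \prod_(e in S) w e.
Proof.
move=> qw /forall_inP S2.
(* The sum over graphs factors over sets e: [Y e] is the weighted sign when e is present, [N e] when
   it is absent. They add up to w e on S and to 1 elsewhere. Sets that are not pairs get [Y] = 0 and
   [N] = 1, so only genuine edge sets survive the expansion. *)
pose Y (e : {set 'I_n}) : R := if #|e| == 2%N then
  (1 + w e) / 2 else 0.
pose N (e : {set 'I_n}) : R := if #|e| == 2%N then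
  (1 - w e) / 2 * (if e \in S then - 1 else 1) else 1.
transitivity (\prod_e (Y e + N e)).
  rewrite bigA_distr [RHS](bigID (fun E => edge_set_axiom E)) /=.
  rewrite [X in _ = _ + X]big1 ?addr0 => [|E]; last first.
    rewrite negb_forall_in => /exists_inP[e eE eN2].
    by rewrite (bigD1 e) //= eE /Y (negPf eN2) mul0r.
  rewrite -(sum_sgraph (fun E => \prod_e (if e \in E then Y e else N e))).
  apply: eq_bigr => G _.
  have -> : indep_edges_pmf q G = \prod_(e : {set 'I_n} | #|e| == 2%N)
      (if e \in edges G then (1 + w e) / 2 else (1 - w e) / 2).
    rewrite -prod_pairs; apply: eq_bigr => i _; apply: eq_bigr => j ij.
    rewrite qw; last by rewrite -val_eqE ltn_eqF.
    by rewrite /adj; case: ifP => // _; field.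
  rewrite /sign_prod [X in _ * X]big_mkcond /=.
  rewrite [X in _ * X](bigID (fun e : {set 'I_n} => #|e| == 2%N)) /=.
  rewrite [X in _ * (_ * X)]big1 ?mulr1 => [|e eN2]; last first.
    by case: ifP => // /S2; rewrite (negPf eN2).
  rewrite [RHS](bigID (fun e : {set 'I_n} => #|e| == 2%N)) /=.
  rewrite [X in _ = _ * X]big1 ?mulr1 => [|e eN2]; last first.
    rewrite /N (negPf eN2); case: ifP => // /card_edge /eqP.
    by rewrite (negPf eN2).
  rewrite -big_split /=; apply: eq_bigr => e e2; rewrite /Y /N e2.
  by do 2!case: ifP => _; rewrite ?mulr1 // ?mulr1n ?mulr0n; ring.
rewrite [RHS]big_mkcond; apply: eq_bigr => e _; rewrite /Y /N.
case: ifPn => [_|eN2]; first by case: ifP => _; field.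
by case: ifP => [/S2|_]; rewrite ?(negPf eN2) ?add0r.
Qed.

Lemma sign_prod_sq (R : realType) (T : finType) (G : sgraph T) (e : {set T}) :
  (2 * (e \in edges G)%:R - 1) * (2 * (e \in edges G)%:R - 1) = 1 :> R.
Proof. by case: (e \in _) => /=; ring. Qed.

Definition symdiff (T : finType) (A B : {set T}) : {set T} :=
  (A :\: B) :|: (B :\: A).

(** Signs square to 1, so the common factors cancel. *)
Lemma sign_prodM (R : realType) (T : finType) (G : sgraph T)
    (A B : {set {set T}}) :
  sign_prod R A G * sign_prod R B G = sign_prod R (symdiff A B) G.
Proof.
rewrite /sign_prod !(big_mkcond (fun e => e \in _)) /= -big_split /=.
apply: eq_bigr => e _; rewrite !inE.
by case: (e \in A); case: (e \in B); rewrite /= ?sign_prod_sq ?mulr1 ?mul1r.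
Qed.

Lemma symdiff_edge_set (T : finType) (A B : {set {set T}}) :
  edge_set_axiom A -> edge_set_axiom B -> edge_set_axiom (symdiff A B).
Proof.
move=> /forall_inP hA /forall_inP hB; apply/forall_inP => e.
by rewrite !inE => /orP[] /andP[_]; [apply: hA | apply: hB].
Qed.

Lemma fexpect_sum (R : realType) (T I : finType) (P : T -> R) (D : pred I)
    (F : I -> T -> R) :
  fexpect P (fun t => \sum_(i | D i) F i t) = \sum_(i | D i) fexpect P (F i).
Proof.
rewrite /fexpect exchange_big /=; apply: eq_bigr => t _.
by rewrite mulr_sumr.
Qed.

Lemma eq_fexpect (R : realType) (T : finType) (P : T -> R) (f g : T -> R) :
  f =1 g -> fexpect P f = fexpect P g.
Proof. by move=> fg; apply: eq_bigr => t _; rewrite fg. Qed.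

Lemma fvarE (R : realType) (T : finType) (P f : T -> R) :
  fexpect P (fun=> 1) = 1 ->
  fvar P f = fexpect P (fun t => f t ^+ 2) - fexpect P f ^+ 2.
Proof.
move=> P1; rewrite /fvar; set m := fexpect P f.
suff -> : fexpect P (fun t => (f t - m) ^+ 2) =
    fexpect P (fun t => f t ^+ 2) - 2 * m * fexpect P f
    + m ^+ 2 * fexpect P (fun=> 1) by rewrite P1 -/m; ring.
rewrite /fexpect; move: m => m.
rewrite !mulr_sumr -sumrB -big_split /=.
by apply: eq_bigr => t _; ring.
Qed.

(** * Mean and variance of a signed count in terms of edge-set moments *)

Section moments.
Variables (R : realType) (T : finType) (H : sgraph T) (n : nat).
Variables (P : sgraph 'I_n -> R) (mu : {set {set 'I_n}} -> R).
Hypothesis mu0 : mu set0 = 1.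
Hypothesis P_mu :
  forall S, edge_set_axiom S -> fexpect P (sign_prod R S) = mu S.

Lemma copies_edge_set c : c \in copies H n -> edge_set_axiom c.2.
Proof.
case/imsetP => f /injectiveP f_inj -> /=; apply/forall_inP => e.
by case/imsetP => e0 /card_edge e2 ->; rewrite card_imset // e2.
Qed.

Lemma fexpect_signed_count :
  fexpect P (signed_count R H (n := n)) = \sum_(c in copies H n) mu c.2.
Proof.
rewrite fexpect_sum; apply: eq_bigr => c /copies_edge_set; exact: P_mu.
Qed.

Lemma fvar_signed_count : fvar P (signed_count R H (n := n)) =
  \sum_(c in copies H n) \sum_(d in copies H n)
    (mu (symdiff c.2 d.2) - mu c.2 * mu d.2).
Proof.
(* The empty sign product is the constant 1, so [mu0] says that P has total mass 1. *)
have P1 : fexpect P (fun=> 1) = 1.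
  rewrite -[RHS]mu0 -P_mu; last by apply/forall_inP => e; rewrite inE.
  by apply: eq_fexpect => G; rewrite /sign_prod big_set0.
rewrite fvarE // fexpect_signed_count expr2 mulr_suml.
have -> : fexpect P (fun G => signed_count R H G ^+ 2) =
    \sum_(c in copies H n) \sum_(d in copies H n) mu (symdiff c.2 d.2).
  transitivity (fexpect P (fun G => \sum_(c in copies H n)
      \sum_(d in copies H n) sign_prod R (symdiff c.2 d.2) G)).
    apply: eq_fexpect => G; rewrite expr2 mulr_suml; apply: eq_bigr => c _.
    by rewrite mulr_sumr; apply: eq_bigr => d _; rewrite -sign_prodM.
  rewrite fexpect_sum; apply: eq_bigr => c cH.
  rewrite fexpect_sum; apply: eq_bigr => d dH.
  by apply/P_mu/symdiff_edge_set; apply: copies_edge_set.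
rewrite -sumrB; apply: eq_bigr => c _.
by rewrite mulr_sumr -sumrB.
Qed.

End moments.

(** * Uniform random labels and the moments of the block model *)

Section labels.
Variables (R : realType) (n : nat).

Definition lmean (F : {ffun 'I_n -> 'I_2} -> R) : R :=
  (1 / 2) ^+ n * \sum_x F x.

Lemma eq_lmean F F' : F =1 F' -> lmean F = lmean F'.
Proof. by move=> FF'; congr (_ * _); apply: eq_bigr => x _. Qed.

Lemma lmean_cst c : lmean (fun=> c) = c.
Proof.
rewrite /lmean sumr_const cardT -cardE card_ffun !card_ord -[c *+ _]mulr_natl.
rewrite mulrA natrX -exprMn; have -> : 1 / 2 * 2 = 1 :> R by field.
by rewrite expr1n mul1r.
Qed.

Lemma lmeanD F F' : lmean (fun x => F x + F' x) = lmean F + lmean F'.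
Proof. by rewrite /lmean big_split mulrDr. Qed.

Lemma lmeanZ c F : lmean (fun x => c * F x) = c * lmean F.
Proof. by rewrite /lmean -mulr_sumr mulrCA. Qed.

Lemma ler_norm_lmean F c : (forall x, `|F x| <= c) -> `|lmean F| <= c.
Proof.
move=> Fc; rewrite -(lmean_cst c) /lmean normrM ger0_norm ?exprn_ge0 //.
by rewrite ler_wpM2l ?exprn_ge0 // (le_trans (ler_norm_sum _ _ _)) // ler_sum.
Qed.

Lemma lmean_involutive (h : {ffun 'I_n -> 'I_2} -> {ffun 'I_n -> 'I_2}) F :
  involutive h -> lmean (F \o h) = lmean F.
Proof.
by move=> hK; rewrite /lmean [in RHS](reindex_inj (inv_inj hK)).
Qed.

(* Integrating over two independent labelings x and y, exchanging x and y on
   the vertices of V turns F x * F' x into F y * F' x. *)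
Lemma lmean_indep (V : {set 'I_n}) (F F' : {ffun 'I_n -> 'I_2} -> R) :
  (forall x y : {ffun 'I_n -> 'I_2}, {in V, x =1 y} -> F x = F y) ->
  (forall x y : {ffun 'I_n -> 'I_2}, {in ~: V, x =1 y} -> F' x = F' y) ->
  lmean (fun x => F x * F' x) = lmean F * lmean F'.
Proof.
move=> FV F'V.
pose mix (x y : {ffun 'I_n -> 'I_2}) :=
  [ffun i => if i \in V then x i else y i].
pose swap p := (mix p.2 p.1, mix p.1 p.2).
have swapK : involutive swap.
  case=> x y; rewrite /swap /mix /=.
  by apply: injective_projections; apply/ffunP => i; rewrite !ffunE;
    case: (i \in V).
transitivity (lmean (fun y => lmean (fun x => F x * F' x))).
  by rewrite lmean_cst.
have -> : lmean F * lmean F' = lmean (fun y => lmean (fun x => F y * F' x)).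
  by rewrite mulrC -lmeanZ; apply: eq_lmean => y; rewrite lmeanZ mulrC.
rewrite /lmean -!mulr_sumr; congr (_ * (_ * _)).
rewrite !pair_bigA /= (reindex_inj (inv_inj swapK)) /=.
apply: eq_bigr => -[x y] _ /=.
congr (_ * _); first by apply: FV => i iV; rewrite ffunE iV.
by apply: F'V => i; rewrite ffunE inE => /negPf ->.
Qed.

Definition label_sign (k : 'I_2) : R := (-1) ^+ k.

(** Switching the community of every vertex of V preserves the uniform law, so a function negated by
    it has mean zero. *)
Definition flip (x : {ffun 'I_n -> 'I_2}) (V : {set 'I_n}) :=
  [ffun i => if i \in V then rev_ord (x i) else x i].

Lemma flipK V : involutive (flip^~ V).
Proof.
move=> x; apply/ffunP => i; rewrite !ffunE.
by case: (i \in V); rewrite ?rev_ordK.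
Qed.

Lemma label_sign_rev k : label_sign (rev_ord k) = - label_sign k.
Proof.
rewrite /label_sign /=; case: k => -[|[|//]] /= _.
  by rewrite subSS subn0 expr1 expr0.
by rewrite subnn expr1 expr0 opprK.
Qed.

(** Flipping the label of i alone negates the product. *)
Lemma lmean_sign2 i j : i != j ->
  lmean (fun x => label_sign (x i) * label_sign (x j)) = 0.
Proof.
move=> ij; set F := fun x => _; have := lmean_involutive F (flipK [set i]).
have /eq_lmean -> : F \o flip^~ [set i] =1 (fun x => -1 * F x).
  move=> x; rewrite /F /= !ffunE !inE eqxx eq_sym (negPf ij) label_sign_rev.
  by rewrite mulN1r mulNr.
by rewrite lmeanZ; lra.
Qed.

Variable a : R.

(** Summing over e avoids ordering the endpoints; [bias_pair] recovers a (s_i + s_j) / 2. *)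
Definition bias (x : {ffun 'I_n -> 'I_2}) (e : {set 'I_n}) : R :=
  a / 2 * \sum_(i in e) label_sign (x i).

Definition bias_moment (S : {set {set 'I_n}}) : R :=
  lmean (fun x => \prod_(e in S) bias x e).

Lemma bias_pair x i j : i != j ->
  bias x [set i; j] = a / 2 * (label_sign (x i) + label_sign (x j)).
Proof. by move=> ij; rewrite /bias big_setU1 ?inE // big_set1. Qed.

Lemma norm_label_sign k : `|label_sign k| = 1.
Proof. by rewrite /label_sign normrX normrN1 expr1n. Qed.

(** Every edge has bias a, -a or 0. *)
Lemma ler_norm_bias_moment S : 0 <= a -> edge_set_axiom S ->
  `|bias_moment S| <= a ^+ #|S|.
Proof.
move=> a0 /forall_inP S2; apply: ler_norm_lmean => x.
rewrite normr_prod -prodr_const.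
apply: ler_prod => e /S2 /cards2P[i [j [ij ->]]].
rewrite normr_ge0 bias_pair // normrM ger0_norm ?divr_ge0 //=.
have := ler_normD (label_sign (x i)) (label_sign (x j)).
rewrite !norm_label_sign => h.
by apply: le_trans (ler_wpM2l _ h) _; [rewrite divr_ge0 | lra].
Qed.

Lemma bias_moment0 : bias_moment set0 = 1.
Proof.
by rewrite -[RHS](lmean_cst 1); apply: eq_lmean => x; rewrite big_set0.
Qed.

(** Flipping all labels negates each factor, so the mean equals its own negative. *)
Lemma bias_moment_odd (S : {set {set 'I_n}}) : odd #|S| -> bias_moment S = 0.
Proof.
move=> oddS; rewrite /bias_moment; set F := fun x => _.
have := lmean_involutive F (flipK setT).
have /eq_lmean -> : F \o flip^~ setT =1 (fun x => -1 * F x).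
  move=> x; rewrite /F /= (eq_bigr (fun e => - bias x e)) => [|e _].
    by rewrite prodrN -signr_odd oddS expr1.
  rewrite /bias -mulrN -sumrN; congr (_ * _); apply: eq_bigr => i _.
  by rewrite ffunE inE label_sign_rev.
by rewrite lmeanZ; lra.
Qed.

(** The two products depend on the labels of disjoint vertex sets, hence are independent. *)
Lemma bias_momentU (A B : {set {set 'I_n}}) :
  [disjoint cover A & cover B] -> [disjoint A & B] ->
  bias_moment (A :|: B) = bias_moment A * bias_moment B.
Proof.
move=> dcov dAB.
transitivity
  (lmean (fun x => \prod_(e in A) bias x e * \prod_(e in B) bias x e)).
  by apply: eq_lmean => x; rewrite -bigU //; apply: eq_bigl => e; rewrite !inE.
apply: (@lmean_indep (cover A)).
- move=> x y xy; apply: eq_bigr => e eA; congr (_ * _); apply: eq_bigr => i ie.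
  by rewrite xy //; apply/bigcupP; exists e.
- move=> x y xy; apply: eq_bigr => e eB; congr (_ * _); apply: eq_bigr => i ie.
  rewrite xy // inE (disjointFl dcov) //; apply/bigcupP; exists e => //.
Qed.

Lemma bias_moment_star2 i j k : i != j -> i != k -> j != k ->
  bias_moment [set [set i; j]; [set i; k]] = a ^+ 2 / 4.
Proof.
move=> ij ik jk.
have neq : [set i; j] != [set i; k].
  apply/eqP => /setP /(_ j); rewrite !inE eqxx orbT eq_sym (negPf ij).
  by rewrite (negPf jk).
have ssq l : label_sign l * label_sign l = 1.
  by rewrite -expr2 /label_sign -exprM mulnC exprM sqrrN !expr1n.
(* Expand (s_i + s_j) (s_i + s_k) with s_i^2 = 1: the three mixed products have mean zero. *)
transitivity (lmean (fun x => a ^+ 2 / 4 *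
    (1 + (label_sign (x i) * label_sign (x j) +
          (label_sign (x i) * label_sign (x k) +
           label_sign (x j) * label_sign (x k)))))).
  apply: eq_lmean => x; rewrite big_setU1 ?inE //= big_set1 !bias_pair //.
  by rewrite -[X in X + (_ + _)](ssq (x i)); field.
by rewrite lmeanZ !lmeanD lmean_cst !lmean_sign2 //; ring.
Qed.

(** This is the diagonal matrix with entries a and -a. *)
Definition bias_mx : 'M[R]_2 :=
  \matrix_(k, l) (a / 2 * (label_sign k + label_sign l)).

(** Given the labels x, the edges are independent with biases [bias x]; then average over x. *)
Lemma fexpect_sbm S : edge_set_axiom S ->
  fexpect (sbm_pmf (const_mx (1 / 2)) bias_mx (n := n)) (sign_prod R S) =
  bias_moment S.
Proof.
move=> S2; rewrite /bias_moment /lmean mulr_sumr.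
transitivity (\sum_(x : {ffun 'I_n -> 'I_2})
    (1 / 2) ^+ n * fexpect
      (indep_edges_pmf (fun i j => (1 + bias_mx (x i) (x j)) / 2))
      (sign_prod R S)).
  rewrite /fexpect /sbm_pmf; under eq_bigr do rewrite mulr_suml.
  rewrite exchange_big /=; apply: eq_bigr => x _; rewrite mulr_sumr.
  apply: eq_bigr => G _; rewrite mulrA; congr (_ * _ * _).
  by under eq_bigr do rewrite mxE; rewrite prodr_const card_ord.
apply: eq_bigr => x _; congr (_ * _); apply: fexpect_indep_edges => // i j ij.
by rewrite mxE bias_pair.
Qed.

End labels.

(** The case of zero bias, where only the empty product survives. *)
Lemma fexpect_er (R : realType) (n : nat) (S : {set {set 'I_n}}) :
  edge_set_axiom S ->
  fexpect (@er_pmf R n) (sign_prod R S) = (S == set0)%:R.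
Proof.
move=> S2; rewrite (@fexpect_indep_edges _ _ (fun=> 0)) //; last first.
  by move=> i j _; field.
have [->|[e eS]] := set_0Vmem S; first by rewrite big_set0 eqxx.
by rewrite (bigD1 e) //= mul0r; case: eqP eS => // ->; rewrite inE.
Qed.

Lemma bias_mx_params (R : realType) (a : R) : 0 <= a <= 1 ->
  sbm_params (const_mx (1 / 2)) (bias_mx a).
Proof.
move=> /andP[a0 a1]; split.
- by move=> k; rewrite mxE; lra.
- by rewrite !big_ord_recl big_ord0 !mxE; lra.
- by move=> k l; rewrite !mxE addrC.
- move=> k l; rewrite mxE -ler_norml normrM ger0_norm ?divr_ge0 //.
  have := ler_normD (label_sign R k) (label_sign R l).
  rewrite !norm_label_sign => h.
  by apply: le_trans (ler_wpM2l _ h) _; [rewrite divr_ge0 | lra].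
Qed.

(** * Connected graphs with few edges *)

Lemma connected_card_vertices (T : finType) (H : sgraph T) :
  connected_graph H -> (#|T| <= #|edges H|.+1)%N.
Proof.
case=> T0 conn; pose inside (A : {set T}) := [set e in edges H | e \subset A].
(* Grow A one vertex at a time along an edge leaving it; each new vertex brings an edge that was not
   inside A before. *)
have grow k : (k < #|T|)%N ->
    exists2 A : {set T}, #|A| = k.+1 & (k <= #|inside A|)%N.
  elim: k => [_|k IH lt_k].
    by case/card_gt0P: T0 => r _; exists [set r]; rewrite ?cards1.
  have [A cardA insA] := IH (ltnW lt_k).
  have [x xA [y [yA xy]]] :
      exists2 x, x \in A & exists y, y \notin A /\ adj H x y.
    have /card_gt0P[x xA] : (0 < #|A|)%N by rewrite cardA.
    have /card_gt0P[z] : (0 < #|~: A|)%N.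
      by rewrite cardsCs setCK cardA subn_gt0.
    rewrite inE => zA; apply: contrapT => noedge.
    (* If no edge left A, then A would be closed under adjacency and contain z. The symmetry of
       [connect] that [intro_closed] asks for holds because all vertices are connected. *)
    have /closed_connect /(_ _ _ (conn x z)) : fingraph.closed (adj H) (mem A).
      apply: intro_closed => [u v|u v uv uA].
        apply/idP/idP => _; exact: conn.
      apply: contrapT => /negP vA; apply: noedge.
      by exists u => //; exists v.
    by move=> E; move: zA; rewrite -[z \in A]E xA.
  exists (y |: A); first by rewrite cardsU1 yA cardA.
  apply: (@leq_trans #|[set x; y] |: inside A|).
    rewrite cardsU1 (_ : [set x; y] \notin inside A) // inE negb_and.
    by rewrite subUset !sub1set (negPf yA) andbF orbT.
  apply: subset_leq_card; apply/subsetP => e.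
  rewrite !inE => /orP[/eqP ->|/andP[-> eA]].
    by apply/andP; split=> //; rewrite subUset !sub1set !inE xA eqxx orbT.
  exact: (subset_trans eA (subsetUr _ _)).
have /grow[A _ leA] : (#|T|.-1 < #|T|)%N by rewrite ltn_predL.
rewrite -(ltn_predK T0) ltnS (leq_trans leA) // subset_leq_card //.
by apply/subsetP => e; rewrite inE => /andP[].
Qed.

Lemma star2_edges : edges (star 2) =
  [set [set ord0; inord 1]; [set ord0; inord 2]].
Proof.
apply/setP => e; rewrite !inE; apply/imsetP/orP => [[i]|].
  rewrite !inE => i0 ->; case: i i0 => -[|[|[|//]]] lti //= _; [left|right];
  by apply/eqP; congr [set _; _]; apply: val_inj; rewrite /= inordK.
by case=> /eqP ->; [exists (inord 1)|exists (inord 2)]; rewrite ?inE //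
  -val_eqE /= inordK.
Qed.

Lemma set2_inj (T : finType) (x y z : T) : [set x; y] = [set x; z] -> y = z.
Proof.
move=> /setP E; move: (E y) (E z); rewrite !inE !eqxx !orbT.
by case/esym/orP => /eqP // -> /orP[] /eqP.
Qed.

Lemma card_star2_edges : #|edges (star 2)| = 2%N.
Proof.
rewrite star2_edges cards2.
suff -> : [set ord0; inord 1] != [set ord0; inord 2 : 'I_3] by [].
by apply/eqP => /set2_inj /eqP; rewrite -val_eqE /= !inordK.
Qed.

(** There are at most three vertices, so the two edges meet in some c, which is sent to the center
    [ord0]. *)
Lemma connected_two_edges_star2 (T : finType) (H : sgraph T) :
  connected_graph H -> #|edges H| = 2%N -> isomorphic H (star 2).
Proof.
move=> Hc /eqP H2; have := connected_card_vertices Hc.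
rewrite (eqP H2) => cardT.
have /cards2P[e1 [e2 [neq edgesE]]] := H2.
have c1 : #|e1| = 2%N by apply: (@card_edge _ H); rewrite edgesE !inE eqxx.
have c2 : #|e2| = 2%N by apply: (@card_edge _ H); rewrite edgesE !inE eqxx orbT.
have cI : (0 < #|e1 :&: e2|)%N.
  have leU : (#|e1 :|: e2| <= 3)%N by apply: leq_trans cardT; apply: max_card.
  have := cardsUI e1 e2; rewrite c1 c2; lia.
have /card_gt0P[c] := cI; rewrite inE => /andP[ce1 ce2].
have ex (e : {set T}) : #|e| = 2%N -> c \in e ->
    exists2 u, u != c & e = [set c; u].
  move=> /eqP /cards2P[u [v [uv ->]]]; rewrite !inE => /orP[] /eqP ->.
    by exists v; rewrite // eq_sym.
  by exists u; rewrite // setUC.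
have [u uc e1E] := ex _ c1 ce1; have [v vc e2E] := ex _ c2 ce2.
have uv : u != v by apply: contra_neq neq => uv; rewrite e1E e2E uv.
have cuv3 : #|[set c; u; v]| = 3%N.
  rewrite -setUA cardsU1 cards2 !inE eq_sym (negPf uc) eq_sym (negPf vc).
  by rewrite uv.
have Tcuv x : [|| x == c, x == u | x == v].
  have : [set c; u; v] = setT.
    by apply/eqP; rewrite eqEcard subsetT cardsT cuv3.
  by move/setP/(_ x); rewrite !inE -orbA.
pose f x : 'I_3 := if x == c then ord0 else if x == u then inord 1 else inord 2.
have o01 : (ord0 == inord 1 :> 'I_3) = false by rewrite -val_eqE /= inordK.
have o02 : (ord0 == inord 2 :> 'I_3) = false by rewrite -val_eqE /= inordK.
have o12 : (inord 1 == inord 2 :> 'I_3) = false by rewrite -val_eqE /= !inordK.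
have fc : f c = ord0 by rewrite /f eqxx.
have fu : f u = inord 1 by rewrite /f (negPf uc) eqxx.
have fv : f v = inord 2 by rewrite /f (negPf vc) eq_sym (negPf uv).
have f_inj : injective f.
  move=> x y.
  case/or3P: (Tcuv x) => /eqP ->; case/or3P: (Tcuv y) => /eqP ->;
    rewrite ?fc ?fu ?fv // => /eqP;
    by rewrite ?o01 ?o02 ?o12 // eq_sym ?o01 ?o02 ?o12.
exists f.
  by apply: (inj_card_bij f_inj); rewrite card_ord -cuv3 max_card.
move=> x y; rewrite /adj star2_edges edgesE e1E e2E -fc -fu -fv.
have fset2 z w : [set f z; f w] = f @: [set z; w] by rewrite imsetU1 imset_set1.
rewrite !fset2 !inE !(inj_eq (imset_inj f_inj)).
by [].
Qed.

(** * Counting copies *)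

Lemma card_copies_le (T : finType) (H : sgraph T) (n : nat) :
  (#|copies H n| <= n ^ #|T|)%N.
Proof.
rewrite (leq_trans (leq_imset_card _ _)) //.
by rewrite (leq_trans (max_card _)) // card_ffun card_ord.
Qed.

(* A copy with vertex set V comes from at most |T|^|T| embeddings, since these
   are maps from T to V and |V| = |T|. *)
Lemma card_copies_ge (T : finType) (H : sgraph T) (n : nat) :
  (n ^_ #|T| <= #|copies H n| * #|T| ^ #|T|)%N.
Proof.
pose inj := [set f : {ffun T -> 'I_n} | injectiveb f].
pose copy (f : {ffun T -> 'I_n}) : {set 'I_n} * {set {set 'I_n}} :=
  (f @: [set: T], [set f @: (e : {set T}) | e in edges H]).
have copyE f : f \in inj -> copy f \in copies H n.
  by rewrite inE => f_inj; apply/imsetP; exists f.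
have := card_inj_ffuns T 'I_n; rewrite card_ord -/inj => <-.
rewrite -sum1_card (partition_big copy (mem (copies H n))) //=.
rewrite -sum_nat_const; apply: leq_sum => c /imsetP[g /injectiveP g_inj cE].
have cV : #|c.1| = #|T| by rewrite cE card_imset // cardsT.
rewrite -[X in (_ <= X ^ _)%N]cV -card_ffun_on sum1_card subset_leq_card //.
apply/subsetP => f /andP[_ /eqP fc]; apply/ffun_onP => x.
by rewrite -fc imset_f.
Qed.

Lemma card_copy_edges (T : finType) (H : sgraph T) (n : nat) c :
  c \in copies H n -> #|c.2| = #|edges H|.
Proof.
case/imsetP => f /injectiveP f_inj ->.
by rewrite card_imset //; apply: imset_inj.
Qed.

(** The path with center i and leaves j, k. *)
Definition star2_copy (n : nat) (i j k : 'I_n) :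
    {set 'I_n} * {set {set 'I_n}} :=
  ([set i; j; k], [set [set i; j]; [set i; k]]).

Lemma star2_copyC (n : nat) (i j k : 'I_n) :
  star2_copy i j k = star2_copy i k j.
Proof. by rewrite /star2_copy setUAC [X in (_, X)]setUC. Qed.

Lemma copies_star2P (n : nat) c : c \in copies (star 2) n ->
  exists i j k : 'I_n, [/\ i != j, i != k, j != k & c = star2_copy i j k].
Proof.
case/imsetP => f /injectiveP f_inj ->.
exists (f ord0), (f (inord 1)), (f (inord 2)).
rewrite !(inj_eq f_inj) -!val_eqE /= !inordK //; split=> //.
rewrite /star2_copy -[star_edges 2]/(edges (star 2)) star2_edges.
rewrite imsetU1 imset_set1 !imsetU1 !imset_set1.
have -> : [set: 'I_3] = [set ord0; inord 1; inord 2].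
  apply/setP => i; rewrite !inE.
  by case: i => -[|[|[|//]]] lti; rewrite -!val_eqE /= ?inordK.
by rewrite !imsetU !imset_set1.
Qed.

(** Either x is the center or, by the symmetry of the leaves, the first leaf; the other two vertices
    are free in both cases. *)
Lemma card_star2_vertex (n : nat) (x : 'I_n) :
  (#|[set c in copies (star 2) n | x \in c.1]| <= 2 * n ^ 2)%N.
Proof.
pose A := [set star2_copy x p.1 p.2 | p : 'I_n * 'I_n].
pose B := [set star2_copy p.1 x p.2 | p : 'I_n * 'I_n].
apply: (@leq_trans #|A :|: B|).
  apply: subset_leq_card; apply/subsetP => c; rewrite inE => /andP[].
  case/copies_star2P => i [j [k [_ _ _ ->]]] /=.
  rewrite !inE -orbA => /or3P[] /eqP xE; rewrite /A /B xE; apply/orP.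
  - by left; apply/imsetP; exists (j, k).
  - by right; apply/imsetP; exists (i, k).
  - by right; rewrite star2_copyC; apply/imsetP; exists (i, j).
rewrite (leq_trans (leq_card_setU _ _)) // mul2n -addnn leq_add //.
  by rewrite (leq_trans (leq_imset_card _ _)) // card_prod card_ord.
by rewrite (leq_trans (leq_imset_card _ _)) // card_prod card_ord.
Qed.

(** One of the two endpoints of e is the center, and only the other leaf is free. *)
Lemma card_star2_edge (n : nat) (e : {set 'I_n}) :
  (#|[set c in copies (star 2) n | e \in c.2]| <= 2 * n)%N.
Proof.
(* Any member [c0] of the family certifies that e is a pair; an empty family is trivial. *)
have [->|[c0]] := set_0Vmem [set c in copies (star 2) n | e \in c.2].
  by rewrite cards0.
rewrite inE => /andP[/copies_edge_set/forall_inP c0e].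
move=> /c0e /cards2P[x [y [xy eE]]].
apply: (@leq_trans #|[set star2_copy x y k | k : 'I_n] :|:
                     [set star2_copy y x k | k : 'I_n]|).
  apply: subset_leq_card; apply/subsetP => c; rewrite inE => /andP[].
  have two i j k : e = [set i; j] -> star2_copy i j k \in
    [set star2_copy x y k | k : 'I_n] :|: [set star2_copy y x k | k : 'I_n].
    rewrite eE => exy; have : x \in [set i; j] by rewrite -exy !inE eqxx.
    rewrite !inE; case/orP => /eqP xE; subst x.
      move/set2_inj: exy => ->; apply/orP; left; apply/imsetP.
      by exists k.
    move: exy; rewrite [RHS]setUC => /set2_inj ->; apply/orP; right.
    by apply/imsetP; exists k.
  case/copies_star2P => i [j [k [_ _ _ ->]]] /=.
  rewrite !inE => /orP[] /eqP /two; first by move/(_ k); rewrite !inE.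
  by move/(_ j); rewrite star2_copyC !inE.
rewrite (leq_trans (leq_card_setU _ _)) // mul2n -addnn leq_add //.
  by rewrite (leq_trans (leq_imset_card _ _)) // card_ord.
by rewrite (leq_trans (leq_imset_card _ _)) // card_ord.
Qed.

Lemma copies_star2_cover (n : nat) c :
  c \in copies (star 2) n -> cover c.2 = c.1.
Proof.
case/copies_star2P => i [j [k [_ _ _ ->]]] /=.
by rewrite /cover bigcup_setU !big_set1; apply/setP => l; rewrite !inE; lia.
Qed.

(** The star has no isolated vertex, so the edges of a copy determine its vertex set. *)
Lemma copies_star2_inj (n : nat) :
  {in copies (star 2) n &, injective (fun c => c.2)}.
Proof.
case=> [V E] [V' E'] /copies_star2_cover /= <- /copies_star2_cover /= <-.
by move=> ->.
Qed.

Lemma card_symdiff (T : finType) (A B : {set T}) :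
  (#|symdiff A B| + 2 * #|A :&: B| = #|A| + #|B|)%N.
Proof.
rewrite cardsU (_ : (A :\: B) :&: (B :\: A) = set0); last first.
  by apply/setP => x; rewrite !inE; case: (x \in A); case: (x \in B).
rewrite cards0 subn0 -(cardsID B A) -(cardsID A B) (setIC B A); lia.
Qed.

Lemma symdiff_eq0 (T : finType) (A B : {set T}) :
  (symdiff A B == set0) = (A == B).
Proof.
by rewrite setU_eq0 !setD_eq0 eqEsubset.
Qed.

(** Double counting of the pairs (d, x) with x in both A and [g d]. *)
Lemma sum_card_setI (T I : finType) (D : pred I) (A : {set T})
    (g : I -> {set T}) :
  (\sum_(d in D) #|A :&: g d| = \sum_(x in A) #|[set d in D | x \in g d]|)%N.
Proof.
transitivity (\sum_(d in D) \sum_(x in A) (x \in g d : nat))%N.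
  apply: eq_bigr => d _; rewrite -sum1_card -big_mkcondr /=.
  by apply: eq_bigl => x; rewrite inE.
rewrite exchange_big; apply: eq_bigr => x _; rewrite -big_mkcondr /= -sum1_card.
by apply: eq_bigl => d; rewrite inE.
Qed.

(** * The signed count under G(n, 1/2) *)

Section erdos_renyi.
Variables (R : realType) (T : finType) (H : sgraph T) (n : nat).
Hypothesis H0 : (0 < #|edges H|)%N.

Lemma copy_edges_neq0 c : c \in copies H n -> (c.2 == set0) = false.
Proof. by move=> /card_copy_edges cE; rewrite -cards_eq0 cE eqn0Ngt H0. Qed.

Lemma fexpect_er_signed_count :
  fexpect (@er_pmf R n) (signed_count R H (n := n)) = 0.
Proof.
rewrite (fexpect_signed_count H (@fexpect_er R n)) big1 // => c cH.
by rewrite copy_edges_neq0.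
Qed.

Lemma fvar_er_signed_count :
  fvar (@er_pmf R n) (signed_count R H (n := n)) =
  \sum_(c in copies H n) \sum_(d in copies H n) (c.2 == d.2)%:R.
Proof.
rewrite (@fvar_signed_count _ _ H n _ (fun S => (S == set0)%:R)); first last.
- exact: fexpect_er.
- by rewrite eqxx.
apply: eq_bigr => c cH; apply: eq_bigr => d _.
by rewrite symdiff_eq0 copy_edges_neq0 // mul0r subr0.
Qed.

(** The diagonal pairs already give the bound. If H has isolated vertices, distinct copies may share
    their edge set, so equality can fail. *)
Lemma ler_card_copies_fvar_er :
  #|copies H n|%:R <= fvar (@er_pmf R n) (signed_count R H (n := n)).
Proof.
rewrite fvar_er_signed_count -sum1_card natr_sum; apply: ler_sum => c cH.
by rewrite (bigD1 c) //= eqxx lerDl sumr_ge0.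
Qed.

End erdos_renyi.

(** By [copies_star2_inj] only the diagonal pairs contribute. *)
Lemma fvar_er_star2 (R : realType) (n : nat) :
  fvar (@er_pmf R n) (signed_count R (star 2) (n := n)) =
  #|copies (star 2) n|%:R.
Proof.
rewrite fvar_er_signed_count; last by rewrite card_star2_edges.
rewrite -sum1_card natr_sum; apply: eq_bigr => c cH.
rewrite (bigD1 c) //= eqxx big1 ?addr0 // => d /andP[dH dc].
by case: eqP => // /copies_star2_inj cd; rewrite cd ?eqxx in dc.
Qed.

(** * The signed count under the block model *)

Section sbm.
Variables (R : realType) (n : nat) (a : R).
Hypothesis a0 : 0 <= a.

Let P := sbm_pmf (const_mx (1 / 2)) (bias_mx a) (n := n).

Lemma mean_gap_sbm (T : finType) (H : sgraph T) : (0 < #|edges H|)%N ->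
  `|fexpect P (signed_count R H (n := n)) -
    fexpect (@er_pmf R n) (signed_count R H (n := n))| =
  `|\sum_(c in copies H n) bias_moment a c.2|.
Proof.
move=> H0; rewrite fexpect_er_signed_count // subr0.
by rewrite (fexpect_signed_count H (@fexpect_sbm R n a)).
Qed.

Lemma copies_star2_moment c : c \in copies (star 2) n ->
  bias_moment a c.2 = a ^+ 2 / 4.
Proof.
by case/copies_star2P => i [j [k [ij ik jk ->]]]; apply: bias_moment_star2.
Qed.

(** The three terms handle in turn a shared vertex without a shared edge (four edges remain), one
    shared edge (two remain), and equality. Cardinalities replace indicators so that [sum_card_setI]
    can sum the bound over d. *)
Lemma cov_star2_le c d : c \in copies (star 2) n -> d \in copies (star 2) n ->
  bias_moment a (symdiff c.2 d.2) - bias_moment a c.2 * bias_moment a d.2 <=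
  #|c.1 :&: d.1|%:R * a ^+ 4 + #|c.2 :&: d.2|%:R * a ^+ 2 + (d == c)%:R.
Proof.
move=> cH dH.
have rhs0 : 0 <= #|c.1 :&: d.1|%:R * a ^+ 4 + #|c.2 :&: d.2|%:R * a ^+ 2 +
    (d == c)%:R by rewrite !addr_ge0 // mulr_ge0 // exprn_ge0.
have c2 := card_copy_edges cH; have d2 := card_copy_edges dH.
rewrite card_star2_edges in c2 d2.
have sd : #|symdiff c.2 d.2| = (4 - 2 * #|c.2 :&: d.2|)%N.
  by rewrite -(addnK (2 * #|c.2 :&: d.2|)%N #|_|) card_symdiff c2 d2.
have [dis|ndis] := boolP [disjoint c.1 & d.1].
  have dis2 : [disjoint c.2 & d.2].
    apply/pred0P => e /=; apply/negbTE/andP => -[ec ed].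
    have /forall_inP/(_ _ ec)/eqP e2 := copies_edge_set cH.
    have /card_gt0P[x xe] : (0 < #|e|)%N by rewrite e2.
    move/pred0P: dis => /(_ x) /= /negP[].
    rewrite -(copies_star2_cover cH) -(copies_star2_cover dH).
    by apply/andP; split; apply/bigcupP; exists e.
  rewrite /symdiff (setDidPl dis2) (setDidPl _); last by rewrite disjoint_sym.
  by rewrite bias_momentU ?subrr // !copies_star2_cover.
have sdE := symdiff_edge_set (copies_edge_set cH) (copies_edge_set dH).
have muM : 0 <= bias_moment a c.2 * bias_moment a d.2.
  by rewrite !copies_star2_moment // mulr_ge0 // divr_ge0 // exprn_ge0.
have mu_le := le_trans (ler_norm _) (ler_norm_bias_moment a0 sdE).
apply: (@le_trans _ _ (a ^+ #|symdiff c.2 d.2|)).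
  by rewrite (le_trans _ mu_le) // gerBl.
have J4 : a ^+ 4 <= #|c.1 :&: d.1|%:R * a ^+ 4.
  by rewrite ler_peMl ?exprn_ge0 // ler1n lt0n cards_eq0 setI_eq0.
have a20 : 0 <= a ^+ 2 by rewrite exprn_ge0.
have a40 : 0 <= a ^+ 4 by rewrite exprn_ge0.
have [I0|I0] := eqVneq #|c.2 :&: d.2| 0%N.
  by rewrite sd I0 -addrA (le_trans J4) // lerDl addr_ge0 // mulr_ge0.
have [I1|I1] := eqVneq #|c.2 :&: d.2| 1%N.
  by rewrite sd I1 mul1r addrAC lerDr addr_ge0 // (le_trans a40).
(* With at least two common edges the truncated subtraction in [sd] gives 0, so the copies
   coincide. *)
have sd0 : #|symdiff c.2 d.2| = 0%N.
  by rewrite sd; case: #|_| I0 I1 => [|[|k]] // _ _; rewrite !mulnS.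
move/eqP: (sd0); rewrite cards_eq0 symdiff_eq0 => /eqP /copies_star2_inj cd.
rewrite sd0 expr0 -cd // eqxx lerDr addr_ge0 //; last by rewrite mulr_ge0.
by rewrite mulr_ge0.
Qed.

Lemma fvar_sbm_star2_le : fvar P (signed_count R (star 2) (n := n)) <=
  #|copies (star 2) n|%:R *
    (6 * (n%:R * a ^+ 2) ^+ 2 + 4 * (n%:R * a ^+ 2) + 1).
Proof.
rewrite (@fvar_signed_count _ _ (star 2) n _ (bias_moment a)); first last.
- exact: fexpect_sbm.
- exact: bias_moment0.
rewrite -sumr_const mulr_suml; apply: ler_sum => c cH; rewrite mul1r.
apply: (@le_trans _ _ (\sum_(d in copies (star 2) n) (#|c.1 :&: d.1|%:R * a ^+ 4
    + #|c.2 :&: d.2|%:R * a ^+ 2 + (d == c)%:R))).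
  by apply: ler_sum => d dH; apply: cov_star2_le.
rewrite !big_split /= -!mulr_suml -!natr_sum !sum_card_setI.
have c2 : (#|c.2| <= 2)%N by rewrite (card_copy_edges cH) card_star2_edges.
have c3 : (#|c.1| <= 3)%N.
  have /imsetP[f _ ->] := cH.
  by rewrite (leq_trans (leq_imset_card _ _)) // cardsT card_ord.
(* The constant 6 is three vertices times the factor 2 of [card_star2_vertex]; below, 4 is two edges
   times the 2 of [card_star2_edge]. *)
have vertices : (\sum_(x in c.1) #|[set d in copies (star 2) n | x \in d.1]|
    <= 6 * n ^ 2)%N.
  apply: (@leq_trans (\sum_(x in c.1) 2 * n ^ 2)%N).
    by apply: leq_sum => x _; apply: card_star2_vertex.
  rewrite sum_nat_const mulnA; exact: leq_mul (leq_mul c3 (leqnn 2)) (leqnn _).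
have edges : (\sum_(e in c.2) #|[set d in copies (star 2) n | e \in d.2]|
    <= 4 * n)%N.
  apply: (@leq_trans (\sum_(e in c.2) 2 * n)%N).
    by apply: leq_sum => e _; apply: card_star2_edge.
  rewrite sum_nat_const mulnA; exact: leq_mul (leq_mul c2 (leqnn 2)) (leqnn _).
have same : (\sum_(d in copies (star 2) n) (d == c) = 1)%N.
  by rewrite (bigD1 c) //= eqxx big1 // => d /andP[_ /negPf ->].
rewrite same lerD2r.
have -> : 6 * (n%:R * a ^+ 2) ^+ 2 + 4 * (n%:R * a ^+ 2) =
    (6 * n ^ 2)%:R * a ^+ 4 + (4 * n)%:R * a ^+ 2 :> R.
  by rewrite !natrM; ring.
by rewrite lerD // ler_wpM2r ?exprn_ge0 // ler_nat.
Qed.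

End sbm.

(** * Asymptotics at a = n^(-2/3) *)

Section asymptotics.
Variable R : realType.

(** With t = n^(1/3) as the unit, all exponents become integers: n = t^3 and a = t^(-2). *)
Definition cbrt (n : nat) : R := n%:R `^ 3^-1.

Lemma cbrtK n : cbrt n ^+ 3 = n%:R.
Proof. by rewrite -powR_mulrn ?powR_ge0 // -powRrM mulVf // powRr1. Qed.

Lemma cbrt_ge1 n : (0 < n)%N -> 1 <= cbrt n.
Proof.
move=> n0; rewrite -(@ler_pXn2r _ 3) ?nnegrE ?powR_ge0 ?ler01 //.
by rewrite cbrtK expr1n ler1n.
Qed.

Lemma near_cbrt_ge (A : R) : \forall n \near \oo%classic, A <= cbrt n.
Proof.
(* A may be negative, and cubes are compared on nonnegative numbers. *)
near=> n; apply: (@le_trans _ _ (Num.max A 0)); first by rewrite le_max lexx.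
rewrite -(@ler_pXn2r _ 3) ?nnegrE ?powR_ge0 ?le_max ?lexx ?orbT //.
by rewrite cbrtK; near: n; apply: nbhs_infty_ger.
Unshelve. all: by end_near. Qed.

(** At n = 0 the inverse of 0 is 0, so the value lies in [0, 1] for every n. *)
Definition bias_scale (n : nat) : R := (cbrt n ^+ 2)^-1.

Lemma bias_scale01 n : 0 <= bias_scale n <= 1.
Proof.
rewrite invr_ge0 exprn_ge0 ?powR_ge0 //=.
case: n => [|n]; last first.
  have t1 := cbrt_ge1 (ltn0Sn n).
  by rewrite invf_le1 ?exprn_ege1 ?exprn_gt0 // (lt_le_trans ltr01).
by rewrite /bias_scale /cbrt powR0 ?invr_eq0 ?pnatr_eq0 // expr0n invr0 ler01.
Qed.

Lemma bias_scale_sq n : (0 < n)%N -> n%:R * bias_scale n ^+ 2 = (cbrt n)^-1.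
Proof.
move=> /cbrt_ge1 t1; rewrite -cbrtK /bias_scale; field.
by rewrite gt_eqF // (lt_le_trans ltr01).
Qed.

Lemma cube_le_ffact3 n : (3 <= n)%N -> (n ^ 3 <= 6 * n ^_ 3)%N.
Proof.
case: n => [|[|[|m]]] // _.
rewrite ffactnS ffactnS ffactn1 /= !expnS expn0; nia.
Qed.

(** Up to a constant, N a^4 is the squared ratio of the gap to the null deviation, of order n^3
    n^(-8/3). Here 162 = 6 * 27, with 6 from [cube_le_ffact3] and 27 = 3^3 from [card_copies_ge]. *)
Lemma card_copies_star2_ge n : (3 <= n)%N ->
  cbrt n <= 162 * (#|copies (star 2) n|%:R * bias_scale n ^+ 4).
Proof.
move=> n3; have t1 : 1 <= cbrt n by apply: cbrt_ge1; apply: leq_trans n3.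
have t0 : 0 < cbrt n by apply: lt_le_trans t1.
have : cbrt n ^+ 9 <= 162 * #|copies (star 2) n|%:R.
  rewrite (exprM _ 3 3) cbrtK -natrX -natrM ler_nat.
  have := card_copies_ge (star 2) n; rewrite card_ord.
  have := cube_le_ffact3 n3; lia.
rewrite mulrA /bias_scale -exprVn -exprM => h.
have i0 : 0 <= (cbrt n)^-1 ^+ 8 by rewrite exprn_ge0 // invr_ge0 ltW.
have := ler_wpM2r i0 h.
by rewrite [_ ^+ 9 * _](_ : _ = cbrt n) //; field; rewrite gt_eqF.
Qed.

Let P n := sbm_pmf (const_mx (1 / 2)) (bias_mx (bias_scale n)) (n := n).

Lemma bias_scale_ge0 n : 0 <= bias_scale n.
Proof. by case/andP: (bias_scale01 n). Qed.

Lemma mean_gap_star2 n :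
  mean_gap (star 2) P n = #|copies (star 2) n|%:R * (bias_scale n ^+ 2 / 4).
Proof.
rewrite /mean_gap mean_gap_sbm; last by rewrite card_star2_edges.
rewrite (eq_bigr (fun=> bias_scale n ^+ 2 / 4)); last first.
  by move=> c; apply: copies_star2_moment.
rewrite sumr_const mulr_natl ger0_norm // mulrn_wge0 // divr_ge0 //.
by rewrite exprn_ge0 // bias_scale_ge0.
Qed.

(** Since n a^2 <= 1, the factor is at most 6 + 4 + 1 = 11. *)
Lemma fvar_star2_le n : (0 < n)%N ->
  fvar (@P n) (signed_count R (star 2) (n := n)) <=
  #|copies (star 2) n|%:R * 11.
Proof.
move=> n0; apply: le_trans (fvar_sbm_star2_le n (bias_scale_ge0 n)) _.
rewrite ler_wpM2l // bias_scale_sq //; have t1 := cbrt_ge1 n0.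
have : 0 <= (cbrt n)^-1 <= 1.
  by rewrite invr_ge0 powR_ge0 invf_le1 // (lt_le_trans ltr01).
by case/andP; nra.
Qed.

Lemma distinguishes_star2 : distinguishes (star 2) P.
Proof.
apply/eqoP => eps eps0; near=> n.
have n3 : (3 <= n)%N by near: n; apply: nbhs_infty_ge.
set N : R := #|copies (star 2) n|%:R.
have gap0 : 0 <= mean_gap (star 2) P n by apply: normr_ge0.
have N0 : 0 <= N by [].
(* Both variances are at most 11 N, so it suffices to compare squares. *)
have sq_ge : N * 11 <= (eps * mean_gap (star 2) P n) ^+ 2.
  rewrite mean_gap_star2 -/N.
  (* The threshold collects 11 from the variance, 16 from squaring the 1/4 in the gap, and 162 from
     the count. *)
  have tge : 11 * 16 * 162 / eps ^+ 2 <= cbrt n by near: n; apply: near_cbrt_ge.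
  have := le_trans tge (card_copies_star2_ge n3).
  rewrite ler_pdivrMr ?exprn_gt0 // -/N => h.
  have -> : (eps * (N * (bias_scale n ^+ 2 / 4))) ^+ 2 =
    N * (N * bias_scale n ^+ 4 * eps ^+ 2 / 16) by field.
  rewrite ler_wpM2l //; lra.
have sd_le v : v <= N * 11 -> Num.sqrt v <= eps * mean_gap (star 2) P n.
  move=> vN; rewrite -[leRHS]ger0_norm ?mulr_ge0 // ?(ltW eps0) // -sqrtr_sqr.
  by rewrite ler_wsqrtr // (le_trans vN).
rewrite [X in _ <= _ * X]ger0_norm // ger0_norm; last first.
  by rewrite le_max sqrtr_ge0.
rewrite ge_max !sd_le //.
- by apply: fvar_star2_le; apply: leq_trans n3.
- by rewrite fvar_er_star2 -/N ler_peMr // ler1n.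
Unshelve. all: by end_near. Qed.

Lemma mean_gap_odd (T : finType) (H : sgraph T) n : odd #|edges H| ->
  mean_gap H P n = 0.
Proof.
move=> oddH; rewrite /mean_gap mean_gap_sbm ?odd_gt0 // big1 ?normr0 // => c cH.
by rewrite bias_moment_odd // (card_copy_edges cH).
Qed.

Lemma mean_gap_le (T : finType) (H : sgraph T) n : (0 < #|edges H|)%N ->
  mean_gap H P n <= #|copies H n|%:R * bias_scale n ^+ #|edges H|.
Proof.
move=> H0; rewrite /mean_gap mean_gap_sbm //.
rewrite (le_trans (ler_norm_sum _ _ _)) // mulr_natl -sumr_const.
apply: ler_sum => c cH; rewrite -(card_copy_edges cH).
by rewrite ler_norm_bias_moment ?bias_scale_ge0 // (copies_edge_set cH).
Qed.

(** With m edges, N a^(2m) bounds the squared ratio of the gap to the null deviation. It is at most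
    n^(m + 1) n^(-4m/3) = n^((3 - m)/3). *)
Lemma card_copies_bias_scale_le (T : finType) (H : sgraph T) n :
  connected_graph H -> (4 <= #|edges H|)%N -> (0 < n)%N ->
  #|copies H n|%:R * (bias_scale n ^+ #|edges H|) ^+ 2 <= (cbrt n)^-1.
Proof.
move=> Hc m4 n0; have t1 := cbrt_ge1 n0.
have t0 : 0 < cbrt n by apply: lt_le_trans t1.
(* With m = k + 4, the powers of t = [cbrt n] are t^(3k + 15) and t^(-4k - 16), leaving t^(-1)
   t^(-k). *)
have /subnK mE := m4; set k := (_ - 4)%N in mE.
apply: (@le_trans _ _ (cbrt n ^+ (3 * #|edges H|.+1) *
                      (bias_scale n ^+ #|edges H|) ^+ 2)).
  rewrite ler_wpM2r ?exprn_ge0 ?bias_scale_ge0 // exprM cbrtK -natrX ler_nat.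
  rewrite (leq_trans (card_copies_le H n)) // leq_pexp2l //.
  exact: connected_card_vertices.
have -> : cbrt n ^+ (3 * #|edges H|.+1) * (bias_scale n ^+ #|edges H|) ^+ 2 =
    (cbrt n)^-1 * (cbrt n ^+ k)^-1.
  have -> : cbrt n ^+ (3 * #|edges H|.+1) = cbrt n ^+ k ^+ 3 * cbrt n ^+ 15.
    by rewrite -exprM -exprD -mE; congr (_ ^+ _); lia.
  have -> : (bias_scale n ^+ #|edges H|) ^+ 2 =
      (cbrt n ^+ k ^+ 4 * cbrt n ^+ 16)^-1.
    by rewrite /bias_scale !exprVn -!exprM -exprD -mE; congr (_ ^+ _)^-1; lia.
  have -> : cbrt n ^+ k ^+ 4 * cbrt n ^+ 16 =
      (cbrt n ^+ k ^+ 3 * cbrt n ^+ 15) * (cbrt n ^+ k * cbrt n).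
    by rewrite (exprSr _ 3) (exprSr _ 15) mulrACA.
  have cancelM (x y : R) : x != 0 -> x / (x * y) = y^-1.
    by move=> x0; rewrite invfM mulVKf.
  rewrite cancelM ?[LHS]invfM 1?[LHS]mulrC //.
  by rewrite mulf_neq0 // !expf_neq0 // gt_eqF.
by rewrite ler_piMr ?invf_le1 ?exprn_gt0 ?exprn_ege1 // invr_ge0 ltW.
Qed.

Lemma fails_to_distinguish_connected (T : finType) (H : sgraph T) :
  connected_graph H -> (0 < #|edges H|)%N -> ~ isomorphic H (star 2) ->
  fails_to_distinguish H P.
Proof.
move=> Hc H0 Hstar; apply/eqoP => eps eps0.
have [oddH|evenH] := boolP (odd #|edges H|).
  by near=> n; rewrite mean_gap_odd // normr0 mulr_ge0 // ltW.
(* A positive even number of edges below 4 is 2, which forces the star. *)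
have m4 : (4 <= #|edges H|)%N.
  have := @connected_two_edges_star2 _ _ Hc.
  by case: #|edges H| H0 evenH => [|[|[|[|m]]]] // _ _ /(_ erefl).
near=> n; have n0 : (0 < n)%N by near: n; apply: nbhs_infty_ge.
have t0 : 0 < cbrt n by apply: lt_le_trans (cbrt_ge1 n0).
set N : R := #|copies H n|%:R.
have small : N * (bias_scale n ^+ #|edges H|) ^+ 2 <= eps ^+ 2.
  apply: le_trans (card_copies_bias_scale_le Hc m4 n0) _.
  have : (eps ^+ 2)^-1 <= cbrt n by near: n; apply: near_cbrt_ge.
  by rewrite -[X in _ -> _ <= X]invrK lef_pV2 ?posrE ?invr_gt0 ?exprn_gt0.
have a0 : 0 <= bias_scale n ^+ #|edges H| by rewrite exprn_ge0 ?bias_scale_ge0.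
rewrite ger0_norm ?normr_ge0 // [X in _ <= _ * X]ger0_norm; last first.
  by rewrite le_max sqrtr_ge0.
apply: le_trans (mean_gap_le n H0) _; rewrite -/N.
(* The null deviation alone is a large enough scale. *)
have sqrtN : Num.sqrt N <= sd_scale H P n.
  by rewrite le_max ler_wsqrtr // ler_card_copies_fvar_er.
apply: le_trans (ler_wpM2l (ltW eps0) sqrtN).
(* Cancel one factor sqrt N and square: what remains is [small]. *)
rewrite -[N in leLHS]sqr_sqrtr // expr2 -mulrA mulrC ler_wpM2r ?sqrtr_ge0 //.
rewrite -(@ler_pXn2r _ 2) ?nnegrE ?(ltW eps0) ?mulr_ge0 ?sqrtr_ge0 //.
by rewrite exprMn sqr_sqrtr.
Unshelve. all: by end_near. Qed.

End asymptotics.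

Theorem theoremA4 (R : realType) :
  let p : 'rV[R]_2 := const_mx (1 / 2) in
  exists Q : nat -> 'M[R]_2,
    [/\ forall n : nat, sbm_params p (Q n),
        distinguishes (star 2) (fun n => @sbm_pmf R 2 p (Q n) n)
      & forall (T : finType) (H : sgraph T),
          connected_graph H -> (0 < #|edges H|)%N -> ~ isomorphic H (star 2) ->
          fails_to_distinguish H (fun n => @sbm_pmf R 2 p (Q n) n)].
Proof.
exists (fun n => bias_mx (bias_scale R n)); split.
- by move=> n; apply/bias_mx_params/bias_scale01.
- exact: distinguishes_star2.
- exact: fails_to_distinguish_connected.
Qed.
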